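(* Let $P_1$ and $P_2$ be two probability measures on a space $\mathcal X$ with total variation distance $V$. For every convex function $f:[0,\infty)\to\mathbb R$, $$\inf_Q\big(D_f(P_1\|Q)+D_f(P_2\|Q)\big)\ \ge\ f(1+V)+f(1-V),$$ where the infimum is over all probability measures $Q$ on $\mathcal X$. Moreover, this inequality is sharp in the sense that for every $V\in[0,1]$, the infimum of the left hand side over all pairs of probability measures $P_1,P_2$ (on arbitrary measurable spaces) with total variation distance $V$ equals $f(1+V)+f(1-V)$.
   Context: For a convex function $f:[0,\infty)\to\mathbb R$ and probability measures $P,Q$ on the same space, $D_f(P\|Q):=\int f\left(\frac{dP}{dQ}\right)dQ$ if $P$ is absolutely continuous with respect to $Q$, and $D_f(P\|Q):=\infty$ otherwise. The total variation distance between two probability measures is defined as half the $L^1$ distance between their densities with respect to a common dominating measure. *)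

(* Defs.v *)
From HB Require Import structures.
From mathcomp Require Import all_boot all_order all_algebra.
From mathcomp Require Import all_classical all_reals all_analysis.
From mathcomp Require Import measurable_realfun.

Set Implicit Arguments.
Unset Strict Implicit.
Unset Printing Implicit Defensive.

Import Order.TTheory GRing.Theory Num.Theory.
Import numFieldNormedType.Exports.

Local Open Scope classical_set_scope.
Local Open Scope ring_scope.
Local Open Scope ereal_scope.

(* When nu `<< mu this version of the density is measurable and takes finite
   nonnegative values everywhere, so that f only has to be known on [0, +oo[
   in f_divergence below. *)
Definition density d (T : measurableType d) (R : realType)
    (nu : {finite_measure set T -> \bar R})
    (mu : {sigma_finite_measure set T -> \bar R}) : T -> \bar R :=
  Radon_Nikodym_SigmaFinite.f nu mu.

(* For f convex on [0, +oo[ the negative part of the integrand is integrable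
   (f has an affine minorant there), so the integral is never oo - oo. *)
Definition f_divergence d (T : measurableType d) (R : realType) (f : R -> R)
    (P Q : probability T R) : \bar R :=
  if `[< P `<< Q >] then \int[Q]_x (f (fine (density P Q x)))%:E else +oo.

Section sum_of_finite_measures.
Context d (T : measurableType d) (R : realType).
Variables m1 m2 : {finite_measure set T -> \bar R}.

Let fin_num_measure_add : fin_num_fun (measure_add m1 m2).
Proof.
move=> A mA; rewrite measure_addE.
by rewrite fin_numD !fin_num_measure.
Qed.

HB.instance Definition _ := Measure.on (measure_add m1 m2).
HB.instance Definition _ :=
  Measure_isFinite.Build _ _ _ (measure_add m1 m2) fin_num_measure_add.

End sum_of_finite_measures.

(* P1 + P2 is taken as the common dominating measure; any other
   sigma-finite choice gives the same value, by tv_distanceE. *)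
Definition tv_distance d (T : measurableType d) (R : realType)
    (P1 P2 : probability T R) : \bar R :=
  let mu := measure_add P1 P2 in
  (2^-1)%:E * \int[mu]_x `|density P1 mu x - density P2 mu x|.

Lemma tv_distanceE d (T : measurableType d) (R : realType)
    (P1 P2 : probability T R)
    (mu : {sigma_finite_measure set T -> \bar R}) :
  P1 `<< mu -> P2 `<< mu ->
  tv_distance P1 P2 =
  (2^-1)%:E * \int[mu]_x `|density P1 mu x - density P2 mu x|.
Proof.
move=> P1mu P2mu; rewrite /tv_distance.
set la := measure_add P1 P2; congr *%E.
have P1la : P1 `<< la.
  by apply/null_content_dominatesP => A mA;
    rewrite /la/= measure_addE => /eqP; rewrite padde_eq0// => /andP[/eqP].
have P2la : P2 `<< la.
  by apply/null_content_dominatesP => A mA;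
    rewrite /la/= measure_addE => /eqP; rewrite padde_eq0// => /andP[_ /eqP].
have lamu : la `<< mu.
  have /null_content_dominatesP dom1 := P1mu.
  have /null_content_dominatesP dom2 := P2mu.
  apply/null_content_dominatesP => A mA muA.
  rewrite /la/= measure_addE.
  by rewrite -[RHS]adde0; congr (_ + _); [exact: dom1|exact: dom2].
have mden (nu : {finite_measure set T -> \bar R})
    (m : {sigma_finite_measure set T -> \bar R}) :
    nu `<< m -> measurable_fun [set: T] (density nu m).
  by move=> num; exact: measurable_int (Radon_Nikodym_SigmaFinite.f_integrable num).
have mdiff (m : {sigma_finite_measure set T -> \bar R}) : P1 `<< m -> P2 `<< m ->
    measurable_fun [set: T] (fun x => `|density P1 m x - density P2 m x|).
  move=> P1m P2m; apply: measurableT_comp => //.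
  by apply: emeasurable_funB; exact: mden.
rewrite -(Radon_Nikodym_SigmaFinite.change_of_variables lamu)//; last exact: mdiff.
apply: ae_eq_integral => //; last 1 first.
  have := Radon_Nikodym_SigmaFinite.chain_rule P1la lamu measurableT.
  have := Radon_Nikodym_SigmaFinite.chain_rule P2la lamu measurableT.
  apply: filterS2 => x /(_ I) e2 /(_ I) e1 _.
  rewrite /density e1 e2 /=.
  rewrite -muleBl; last 2 first.
  - exact: Radon_Nikodym_SigmaFinite.f_fin_num.
  - by rewrite fin_num_adde_defr// Radon_Nikodym_SigmaFinite.f_fin_num.
  rewrite abseM; congr *%E.
  by rewrite gee0_abs// Radon_Nikodym_SigmaFinite.f_ge0.
- by apply: emeasurable_funM; [exact: mdiff|exact: mden].
- exact: mdiff.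
Qed.

(* Main.v *)
Require Import Defs.
From HB Require Import structures.
From mathcomp Require Import all_boot all_order all_algebra.
From mathcomp Require Import all_classical all_reals all_analysis.
From mathcomp Require Import measurable_realfun ring lra.

Set Implicit Arguments.
Unset Strict Implicit.
Unset Printing Implicit Defensive.

Import Order.TTheory GRing.Theory Num.Theory.
Import numFieldNormedType.Exports.

Local Open Scope classical_set_scope.
Local Open Scope ring_scope.
Local Open Scope ereal_scope.

(* If neither divergence is infinite, let p1, p2 be the densities of P1, P2 with
   respect to Q. Then f(p1) + f(p2) = f(max(p1, p2)) + f(min(p1, p2)) pointwise,
   and max(p1, p2), min(p1, p2) have Q-integrals 1 + V and 1 - V, so the lower
   bound is Jensen's inequality applied twice. On two points,
   P1 = ((1 + V)/2, (1 - V)/2), its mirror image P2 and the uniform measure Q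
   attain equality. *)

(** * Convex functions on the half-line: chords, supporting lines, measurability *)

Lemma convex_function_chord (R : realType) (f : R -> R) (x y t : R) :
  convex_function (`[0%R, +oo[%classic : set R) f ->
  (0 <= x)%R -> (0 <= y)%R -> (0 <= t <= 1)%R ->
  (f (t * x + (1 - t) * y) <= t * f x + (1 - t) * f y)%R.
Proof.
move=> cf x0 y0 /andP[t0 t1].
by have := cf (Itv01 t0 t1) x y; apply; rewrite inE/= in_itv/= ?x0 ?y0.
Qed.

(** Here [y] is the convex combination of [x] and [z] with weight [(z - y) / (z - x)] on [x].
    Clearing the denominator makes slope comparisons a matter of linear arithmetic. *)
Lemma convex_function_three_points (R : realType) (f : R -> R) (x y z : R) :
  convex_function (`[0%R, +oo[%classic : set R) f ->
  (0 <= x)%R -> (x < y)%R -> (y < z)%R ->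
  ((z - x) * f y <= (z - y) * f x + (y - x) * f z)%R.
Proof.
move=> cf x0 xy yz.
have xz : (0 < z - x)%R by lra.
pose t := ((z - y) / (z - x))%R.
have t01 : (0 <= t <= 1)%R.
  by rewrite /t divr_ge0 ?ler_pdivrMr//; lra.
have z0 : (0 <= z)%R by lra.
have := @convex_function_chord _ _ _ _ _ cf x0 z0 t01.
have -> : (t * x + (1 - t) * z = y)%R by rewrite /t; field; lra.
rewrite -(ler_pM2l xz) => /le_trans; apply.
rewrite le_eqVlt; apply/orP; left; apply/eqP.
by rewrite /t; field; lra.
Qed.

(** Every chord slope to the left of [m] is at most every chord slope to the right, so the supremum
    of the left slopes separates the two families. Positivity of [m] provides points on its left. *)
Lemma convex_function_subgradient (R : realType) (f : R -> R) (m : R) :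
  convex_function (`[0%R, +oo[%classic : set R) f -> (0 < m)%R ->
  exists c : R, forall x, (0 <= x)%R -> (f m + c * (x - m) <= f x)%R.
Proof.
move=> cf m0.
pose A : set R := [set (f m - f x) / (m - x) | x in `[0%R, m[ ]%R.
have A0 : A !=set0.
  by exists ((f m - f 0) / (m - 0))%R, 0%R => //=; rewrite in_itv/= lexx.
have ubA z : (m < z)%R -> ubound A ((f z - f m) / (z - m))%R.
  move=> mz w [x /=]; rewrite in_itv/= => /andP[x0 xm] <-.
  have := @convex_function_three_points _ _ _ _ _ cf x0 xm mz.
  rewrite ler_pdivrMr ?subr_gt0// mulrAC ler_pdivlMr ?subr_gt0//.
  lra.
exists (sup A) => x x0.
have [xm|mx|->] := ltgtP x m; last by rewrite subrr mulr0 addr0.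
- have : (((f m - f x) / (m - x)) <= sup A)%R.
    apply: ub_le_sup; last by exists x => //=; rewrite in_itv/= x0.
    (* The chord from [m] to [m + 1] shows that [A] is bounded above, so that [sup A] is a genuine
       supremum. *)
    by exists ((f (m + 1) - f m) / (m + 1 - m))%R; apply: ubA; lra.
  by rewrite ler_pdivrMr ?subr_gt0//; lra.
- have : (sup A <= (f x - f m) / (x - m))%R by apply: ge_sup => //; exact: ubA.
  by rewrite ler_pdivlMr ?subr_gt0//; lra.
Qed.

(* The sublevel sets are intervals. *)
Lemma convex_function_measurable (R : realType) (f : R -> R) :
  convex_function (`[0%R, +oo[%classic : set R) f ->
  measurable_fun (`[0%R, +oo[%classic : set R) f.
Proof.
move=> cf mD; apply: (measurability _ (RGenInftyO.measurableE R)) => //.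
move=> /= _ [_ [r ->] <-]; apply: is_interval_measurable => x z/=.
rewrite !in_itv/= !andbT => -[x0 fx] [z0 fz] y /andP[xy yz].
split; first by rewrite in_itv/= andbT (le_trans x0 xy).
rewrite in_itv/=.
move: xy yz; rewrite le_eqVlt => /predU1P[<-//|xy].
rewrite le_eqVlt => /predU1P[->//|yz].
have xz : (0 < z - x)%R by lra.
have yx : (0 < y - x)%R by lra.
have zy : (0 < z - y)%R by lra.
rewrite -(ltr_pM2l xz).
apply: le_lt_trans (@convex_function_three_points _ _ _ _ _ cf x0 xy yz) _.
have : ((z - y) * f x < (z - y) * r)%R by rewrite ltr_pM2l.
have : ((y - x) * f z < (y - x) * r)%R by rewrite ltr_pM2l.
lra.
Qed.

(** * Integrability dichotomy and Jensen's inequality *)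

Section integrals.
Context d (T : measurableType d) (R : realType).
Implicit Types (mu : {measure set T -> \bar R}) (Q : probability T R).

(** The negative part of [g] lies below that of [l] and so has finite integral; the two cases are
    whether the positive part does too. *)
Lemma integrable_or_integral_pinfty mu (l g : T -> R) :
  measurable_fun setT g -> mu.-integrable setT (EFin \o l) ->
  (forall x, (l x <= g x)%R) ->
  mu.-integrable setT (EFin \o g) \/ \int[mu]_x (g x)%:E = +oo.
Proof.
move=> mg il lg.
have mg' : measurable_fun setT (EFin \o g) by exact/measurable_EFinP.
have ngoo : \int[mu]_x (EFin \o g)^\- x < +oo.
  apply: le_lt_trans (integral_funeneg_lt_pinfty measurableT il).
  apply: ge0_le_integral => //; try exact: measurable_funeneg.
  - exact/measurable_funeneg/(measurable_int mu).
  - move=> x _; apply: (@funeneg_le _ _ setT _ _ _ _ (mem_set I)) => y _.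
    by rewrite lee_fin lg.
have [pgoo|pgoo] := ltP (\int[mu]_x (EFin \o g)^\+ x) +oo; [left|right].
  apply/integrableP; split => //.
  rewrite -[X in integral _ _ X]/(abse \o (EFin \o g)) fune_abse.
  rewrite ge0_integralD//; [exact: lte_add_pinfty| |].
    exact: measurable_funepos.
  exact: measurable_funeneg.
move: pgoo; rewrite leye_eq => /eqP pgoo.
rewrite integralE pgoo addye// -ltNye lteNr//=.
Qed.

(** For a positive mean [m], integrate the supporting line of [f] at [m]: its linear term has
    integral zero because [Q] has mass 1. *)
Lemma jensen_Rintegral Q (f : R -> R) (h : T -> R) :
  convex_function (`[0%R, +oo[%classic : set R) f ->
  (forall x, (0 <= h x)%R) ->
  Q.-integrable setT (EFin \o h) -> Q.-integrable setT (EFin \o (f \o h)) ->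
  (f (\int[Q]_x h x) <= \int[Q]_x f (h x))%R.
Proof.
move=> cf h0 ih ifh; set m := (\int[Q]_x h x)%R.
have icst c : Q.-integrable setT (EFin \o cst c).
  exact: finite_measure_integrable_cst.
have Icst c : (\int[Q]_x cst c x = c)%R.
  by rewrite Rintegral_cst// (congr1 fine (probability_setT Q)) mulr1.
have : (0 <= m)%R by exact: Rintegral_ge0.
rewrite le_eqVlt => /predU1P[m0|m0].
  have h_ae0 : ae_eq Q setT (EFin \o h) (cst 0).
    apply/ae_eq_integral_abs => //; first exact: (measurable_int Q).
    under eq_integral do rewrite /= ger0_norm//.
    by rewrite -[LHS]fineK ?integrable_fin_num// -/(Rintegral _ _ _) -/m -m0.
  (* f need not have a subgradient at 0, but here h = 0 almost everywhere. *)
  rewrite -[leLHS]Icst le_eqVlt; apply/orP; left; apply/eqP.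
  congr fine; apply: ae_eq_integral => //.
  - exact: (measurable_int _ (icst (f m))).
  - exact: (measurable_int _ ifh).
  by apply: filterS h_ae0 => x /(_ I)[/= hx] _; rewrite hx -m0.
have [c fc] := @convex_function_subgradient _ _ _ cf m0.
have ihm : Q.-integrable setT (EFin \o (fun x => h x - m)%R).
  rewrite (_ : _ \o _ = (EFin \o h) \- (EFin \o cst m))//.
  exact: integrableB.
have ichm : Q.-integrable setT (EFin \o (fun x => c * (h x - m))%R).
  rewrite (_ : _ \o _ = (fun x => c%:E * (EFin \o (fun x => h x - m)%R) x))//.
  exact: integrableZl.
apply: (@le_trans _ _ (\int[Q]_x (f m + c * (h x - m))%R)%R); last first.
  apply: le_Rintegral => // [|x _]; last exact: fc.
  rewrite (_ : _ \o _ = (EFin \o cst (f m)) \+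
    (EFin \o (fun x => c * (h x - m))%R))//.
  exact: integrableD.
rewrite RintegralD//; last exact: (icst (f m)).
rewrite RintegralZl// RintegralB//; last exact: (icst m).
by rewrite (Icst (f m)) (Icst m) subrr mulr0 addr0.
Qed.
End integrals.

(** * Densities and the lower bound *)

Section f_divergence.
Context d (T : measurableType d) (R : realType).
Implicit Types (P Q : probability T R) (f : R -> R).

Lemma EFin_fine_density P Q : P `<< Q ->
  EFin \o (fine \o density P Q) = density P Q.
Proof.
move=> PQ; apply/funext => x /=; rewrite fineK//.
exact: Radon_Nikodym_SigmaFinite.f_fin_num.
Qed.

Lemma fine_density_ge0 P Q x : P `<< Q -> (0 <= fine (density P Q x))%R.
Proof. by move=> PQ; apply/fine_ge0/Radon_Nikodym_SigmaFinite.f_ge0. Qed.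

Lemma integrable_fine_density P Q : P `<< Q ->
  Q.-integrable setT (EFin \o (fine \o density P Q)).
Proof.
move=> PQ; rewrite EFin_fine_density//.
exact: Radon_Nikodym_SigmaFinite.f_integrable.
Qed.

Lemma Rintegral_fine_density P Q : P `<< Q ->
  (\int[Q]_x fine (density P Q x) = 1)%R.
Proof.
move=> PQ; rewrite /Rintegral.
have /(congr1 (fun g => \int[Q]_x g x)) /= -> := EFin_fine_density PQ.
rewrite -(Radon_Nikodym_SigmaFinite.f_integral PQ)//.
exact: (congr1 fine (probability_setT P)).
Qed.

(** Convexity says nothing about [f] on negative reals, so measurability passes through the
    half-line, which contains the range of [h]. *)
Lemma measurable_fun_convex_comp f (h : T -> R) :
  convex_function (`[0%R, +oo[%classic : set R) f ->
  (forall x, (0 <= h x)%R) -> measurable_fun setT h ->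
  measurable_fun setT (f \o h).
Proof.
move=> cf h0 mh; apply: measurable_comp (convex_function_measurable cf) mh => //.
by move=> _ [x _ <-]/=; rewrite in_itv/= h0.
Qed.

(** The supporting line of [f] at 1, composed with the density, is an integrable minorant of the
    integrand. *)
Lemma f_divergence_integrableVpinfty f P Q :
  convex_function (`[0%R, +oo[%classic : set R) f -> P `<< Q ->
  Q.-integrable setT (EFin \o (f \o (fine \o density P Q))) \/
  f_divergence f P Q = +oo.
Proof.
move=> cf PQ; rewrite /f_divergence asboolT//.
have [c fc] := @convex_function_subgradient _ _ _ cf ltr01.
have ip := integrable_fine_density PQ.
apply: (@integrable_or_integral_pinfty _ _ _ _
    (fun x => f 1 + c * (fine (density P Q x) - 1))%R).
- apply: measurable_fun_convex_comp => // [x|]; first exact: fine_density_ge0.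
  exact/measurable_EFinP/(measurable_int Q).
- have icst k : Q.-integrable setT (EFin \o cst k).
    exact: finite_measure_integrable_cst.
  rewrite (_ : _ \o _ = (EFin \o cst (f 1%R)) \+
    (fun x => c%:E * ((EFin \o (fine \o density P Q)) \- (EFin \o cst 1%R)) x))//.
  by apply: integrableD => //; apply: integrableZl => //; exact: integrableB.
- by move=> x; apply: fc; exact: fine_density_ge0.
Qed.

(** Since [+oo + -oo] is [-oo] for this addition, this is what makes a sum of divergences infinite
    as soon as one term is [+oo]. *)
Lemma f_divergence_gtNy f P Q :
  convex_function (`[0%R, +oo[%classic : set R) f -> -oo < f_divergence f P Q.
Proof.
move=> cf; have [PQ|PQ] := pselect (P `<< Q); last first.
  by rewrite /f_divergence asboolF.
have [ifp|->//] := f_divergence_integrableVpinfty cf PQ.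
rewrite /f_divergence asboolT// ltNye.
by have /fin_numP[] := integrable_fin_num measurableT ifp.
Qed.

(** Takes [Q] itself as the dominating measure, so that distance and divergences are integrals of
    the same two densities. *)
Lemma tv_distance_Rintegral P1 P2 Q : P1 `<< Q -> P2 `<< Q ->
  tv_distance P1 P2 =
  (2^-1 * \int[Q]_x `|fine (density P1 Q x) - fine (density P2 Q x)|)%R%:E.
Proof.
move=> P1Q P2Q; rewrite (tv_distanceE P1Q P2Q) EFinM; congr *%E.
have i1 := integrable_fine_density P1Q; have i2 := integrable_fine_density P2Q.
rewrite /Rintegral fineK; last first.
  apply: integrable_fin_num => //.
  apply: (@integrable_norm _ _ _ _ _
    (fun x => fine (density P1 Q x) - fine (density P2 Q x))%R).
  rewrite (_ : _ \o _ = (EFin \o (fine \o density P1 Q)) \-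
    (EFin \o (fine \o density P2 Q)))//.
  exact: integrableB.
apply: eq_integral => x _.
by rewrite -{1}(EFin_fine_density P1Q) -{1}(EFin_fine_density P2Q).
Qed.

Lemma f_divergenceD_ge f P1 P2 Q (V : R) :
  convex_function (`[0%R, +oo[%classic : set R) f ->
  tv_distance P1 P2 = V%:E ->
  (f (1 + V) + f (1 - V))%R%:E <= f_divergence f P1 Q + f_divergence f P2 Q.
Proof.
move=> cf tvV.
have [P1Q|nP1Q] := pselect (P1 `<< Q); last first.
  rewrite {1}/f_divergence asboolF// addye ?leey//.
  by have := f_divergence_gtNy P2 Q cf; rewrite ltNye.
have [P2Q|nP2Q] := pselect (P2 `<< Q); last first.
  rewrite {2}/f_divergence asboolF// addey ?leey//.
  by have := f_divergence_gtNy P1 Q cf; rewrite ltNye.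
have [if1|->] := f_divergence_integrableVpinfty cf P1Q; last first.
  by rewrite addye ?leey//; have := f_divergence_gtNy P2 Q cf; rewrite ltNye.
have [if2|->] := f_divergence_integrableVpinfty cf P2Q; last first.
  by rewrite addey ?leey//; have := f_divergence_gtNy P1 Q cf; rewrite ltNye.
move: tvV; rewrite (tv_distance_Rintegral P1Q P2Q) => -[tvV].
rewrite /f_divergence !asboolT//.
have i1 := integrable_fine_density P1Q; have i2 := integrable_fine_density P2Q.
have p1_ge0 x := fine_density_ge0 x P1Q; have p2_ge0 x := fine_density_ge0 x P2Q.
have I1 := Rintegral_fine_density P1Q; have I2 := Rintegral_fine_density P2Q.
set p1 := fine \o density P1 Q in i1 if1.
set p2 := fine \o density P2 Q in i2 if2.
change (forall x, 0 <= p1 x)%R in p1_ge0.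
change (forall x, 0 <= p2 x)%R in p2_ge0.
change (\int[Q]_x p1 x = 1)%R in I1.
change (\int[Q]_x p2 x = 1)%R in I2.
change (2^-1 * \int[Q]_x `|p1 x - p2 x| = V)%R in tvV.
change ((f (1 + V) + f (1 - V))%R%:E <=
  \int[Q]_x (f (p1 x))%:E + \int[Q]_x (f (p2 x))%:E).
have mp1 : measurable_fun setT p1 by exact/measurable_EFinP/(measurable_int Q).
have mp2 : measurable_fun setT p2 by exact/measurable_EFinP/(measurable_int Q).
pose a := p1 \max p2; pose b := p1 \min p2.
have a_ge0 x : (0 <= a x)%R by rewrite /a/= le_max p1_ge0.
have b_ge0 x : (0 <= b x)%R by rewrite /b/= le_min p1_ge0 p2_ge0.
have ma : measurable_fun setT a by exact: measurable_maxr.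
have mb : measurable_fun setT b by exact: measurable_minr.
(* As the densities are nonnegative, their sum dominates both the maximum and the minimum. *)
have ips : Q.-integrable setT (EFin \o (p1 \+ p2)%R).
  rewrite (_ : _ \o _ = (EFin \o p1) \+ (EFin \o p2))//; exact: integrableD.
have ia : Q.-integrable setT (EFin \o a).
  apply: le_integrable ips => //; first exact/measurable_EFinP.
  move=> x _ /=; rewrite lee_fin !ger0_norm// ?addr_ge0//.
  by rewrite ge_max lerDl lerDr p1_ge0 p2_ge0.
have ib : Q.-integrable setT (EFin \o b).
  apply: le_integrable ips => //; first exact/measurable_EFinP.
  move=> x _ /=; rewrite lee_fin !ger0_norm// ?addr_ge0//.
  by rewrite ge_min lerDl p2_ge0.
(* At each point [(a, b)] is [(p1, p2)] up to order. This bounds [f \o a] and [f \o b] by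
   [|f p1| + |f p2|], and later lets the integrands be exchanged. *)
have fab x : (f (a x) = f (p1 x) /\ f (b x) = f (p2 x)) \/
             (f (a x) = f (p2 x) /\ f (b x) = f (p1 x)).
  by rewrite /a /b/=; have [] := ltP (p1 x) (p2 x); [right|left].
have ifs : Q.-integrable setT (fun x => `|f (p1 x)|%:E + `|f (p2 x)|%:E).
  by apply: integrableD => //; exact: integrable_norm.
have ifa : Q.-integrable setT (EFin \o (f \o a)).
  apply: le_integrable ifs => //.
    by apply/measurable_EFinP; exact: measurable_fun_convex_comp.
  move=> x _ /=; rewrite lee_fin (ger0_norm (addr_ge0 _ _))//.
  by have [[-> _]|[-> _]] := fab x; rewrite ?lerDl ?lerDr.
have ifb : Q.-integrable setT (EFin \o (f \o b)).
  apply: le_integrable ifs => //.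
    by apply/measurable_EFinP; exact: measurable_fun_convex_comp.
  move=> x _ /=; rewrite lee_fin (ger0_norm (addr_ge0 _ _))//.
  by have [[_ ->]|[_ ->]] := fab x; rewrite ?lerDl ?lerDr.
(* The two means come from a linear system: [a + b = p1 + p2] and [a - b = |p1 - p2|] pointwise. *)
have Iab : (\int[Q]_x a x + \int[Q]_x b x = 2)%R.
  rewrite -RintegralD// -[RHS]/(1 + 1)%R -[X in (X + _)%R]I1 -I2 -RintegralD//.
  by apply: eq_Rintegral => x _; rewrite /a/b/= addr_max_min.
have Ia_b : (\int[Q]_x a x - \int[Q]_x b x = 2 * V)%R.
  rewrite -RintegralB// -tvV mulrA divff// mul1r.
  apply: eq_Rintegral => x _; rewrite /a/b/=.
  have [xy|yx] := ltP (p1 x) (p2 x); [rewrite distrC|];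
    by rewrite ger0_norm// subr_ge0// ltW.
have Ia : (\int[Q]_x a x = 1 + V)%R by lra.
have Ib : (\int[Q]_x b x = 1 - V)%R by lra.
rewrite -integralD_EFin//.
rewrite (eq_integral (fun x => (f (a x))%:E + (f (b x))%:E)); last first.
  by move=> x _; have [[-> ->]|[-> ->]] := fab x => //; rewrite addeC.
rewrite integralD_EFin// EFinD -Ia -Ib.
have finK (g : T -> R) : Q.-integrable setT (EFin \o g) ->
    \int[Q]_x (g x)%:E = (\int[Q]_x g x)%R%:E.
  by move=> ig; rewrite /Rintegral fineK// integrable_fin_num.
by apply: leeD; rewrite finK// lee_fin jensen_Rintegral.
Qed.

End f_divergence.

(** * The extremal example on two points *)

Section two_points.
Context (R : realType).
Implicit Types (p q : R).

Lemma integral_set1_cst d (T : measurableType d) (mu : {measure set T -> \bar R})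
    (t : T) (g : T -> R) : measurable [set t] ->
  \int[mu]_(x in [set t]) (g x)%:E = (g t)%:E * mu [set t].
Proof.
move=> mt; rewrite (eq_integral (cst (g t)%:E)) ?integral_cst//.
by move=> x; rewrite inE/= => ->.
Qed.

Lemma integral_bool (mu : probability bool R) (g : bool -> R) :
  \int[mu]_x (g x)%:E =
  (g true)%:E * mu [set true] + (g false)%:E * mu [set false].
Proof.
rewrite setT_bool integral_setU//; first by rewrite !integral_set1_cst.
by rewrite disj_set2E; apply/eqP/seteqP; split => x //= [->].
Qed.

Lemma bernoulli_prob_set1 p b : (0 <= p <= 1)%R ->
  bernoulli_prob p [set b] = (if b then p else 1 - p)%R%:E.
Proof. by move=> p01; rewrite /bernoulli_prob p01 fsbig_set1; case: b. Qed.

(** With [q] strictly between 0 and 1 both atoms have positive mass, so the only null set is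
    empty. *)
Lemma bernoulli_prob_dominates p q : (0 <= p <= 1)%R -> (0 < q < 1)%R ->
  bernoulli_prob p `<< bernoulli_prob q.
Proof.
move=> p01 /andP[q0 q1]; have q01 : (0 <= q <= 1)%R by rewrite !ltW.
apply/null_content_dominatesP => A mA qA0.
suff -> : A = set0 by rewrite measure0.
rewrite -subset0 => b Ab.
have : bernoulli_prob q [set b] <= bernoulli_prob q A.
  by apply: le_measure; rewrite ?inE// => _ ->.
rewrite [X in _ <= X]qA0 bernoulli_prob_set1// lee_fin.
by case: b {Ab} => ?; lra.
Qed.

(** Integrating the density over a single atom gives its value times the mass of that atom, which is
    nonzero and can be divided out. *)
Lemma density_bernoulli_prob p q b : (0 <= p <= 1)%R -> (0 < q < 1)%R ->
  (fine (density (bernoulli_prob p) (bernoulli_prob q) b) =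
   if b then p / q else (1 - p) / (1 - q))%R.
Proof.
move=> p01 q01; have pq := bernoulli_prob_dominates p01 q01.
have q01' : (0 <= q <= 1)%R by case/andP: q01 => *; rewrite !ltW.
set g := fine \o density (bernoulli_prob p) (bernoulli_prob q).
have : bernoulli_prob p [set b] = (g b)%:E * bernoulli_prob q [set b].
  rewrite -integral_set1_cst//.
  rewrite [LHS](Radon_Nikodym_SigmaFinite.f_integral pq)//.
  by have /(congr1 (fun h => \int[_]_(x in _) h x)) <- := EFin_fine_density pq.
rewrite !bernoulli_prob_set1// -EFinM => -[].
rewrite -[fine _]/(g b); move: (g b) => gb.
by case: b => ->; rewrite mulfK// gt_eqF//; lra.
Qed.

(** Against the uniform law the densities take the values [1 + V] and [1 - V], in opposite orders.
    They differ by [2 * V] at each atom, and each divergence is half of [f (1 + V) + f (1 - V)]. *)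
Lemma bernoulli_prob_extremal (f : R -> R) (V : R) : (0 <= V <= 1)%R ->
  let P1 : probability bool R := bernoulli_prob ((1 + V) / 2)%R in
  let P2 : probability bool R := bernoulli_prob ((1 - V) / 2)%R in
  let Q : probability bool R := bernoulli_prob (2^-1)%R in
  tv_distance P1 P2 = V%:E /\
  f_divergence f P1 Q + f_divergence f P2 Q = (f (1 + V) + f (1 - V))%R%:E.
Proof.
move=> /andP[V0 V1] P1 P2 Q.
have h1 : (0 <= (1 + V) / 2 <= 1)%R by lra.
have h2 : (0 <= (1 - V) / 2 <= 1)%R by lra.
have hq : (0 < (2^-1 : R) < 1)%R by lra.
have hq' : (0 <= (2^-1 : R) <= 1)%R by lra.
have P1Q : P1 `<< Q := bernoulli_prob_dominates h1 hq.
have P2Q : P2 `<< Q := bernoulli_prob_dominates h2 hq.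
have d1 b := density_bernoulli_prob b h1 hq.
have d2 b := density_bernoulli_prob b h2 hq.
have e1 : ((1 + V) / 2 / 2^-1 = 1 + V)%R by field.
have e2 : ((1 - V) / 2 / 2^-1 = 1 - V)%R by field.
have e3 : ((1 - (1 + V) / 2) / (1 - 2^-1) = 1 - V)%R by field.
have e4 : ((1 - (1 - V) / 2) / (1 - 2^-1) = 1 + V)%R by field.
have Qb b : Q [set b] = (2^-1)%R%:E.
  by rewrite [LHS](bernoulli_prob_set1 b hq'); case: b => //; congr EFin; lra.
split.
- rewrite (tv_distance_Rintegral P1Q P2Q) /Rintegral integral_bool.
  rewrite !Qb !d1 !d2 e1 e2 e3 e4 -!EFinM -EFinD/=.
  congr EFin.
  have -> : (1 + V - (1 - V) = 2 * V)%R by ring.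
  have -> : (1 - V - (1 + V) = - (2 * V))%R by ring.
  by rewrite normrN ger0_norm ?mulr_ge0//; field.
- rewrite /f_divergence !asboolT// !integral_bool.
  rewrite !Qb !d1 !d2 e1 e2 e3 e4 -!EFinM -!EFinD.
  by congr EFin; field.
Qed.
End two_points.

Theorem mainTheorem3 (R : realType) (f : R -> R)
    (f_convex : convex_function (`[0%R, +oo[%classic : set R) f) :
  (forall (d : measure_display) (T : measurableType d)
      (P1 P2 : probability T R) (V : R),
    tv_distance P1 P2 = V%:E ->
    (f (1 + V) + f (1 - V))%R%:E <=
    ereal_inf [set f_divergence f P1 Q + f_divergence f P2 Q
              | Q in [set: probability T R]]) /\
  (forall V : R, (0 <= V <= 1)%R ->
    ereal_inf [set x : \bar R |
      exists (d : measure_display) (T : measurableType d)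
          (P1 P2 : probability T R),
        tv_distance P1 P2 = V%:E /\
        x = ereal_inf [set f_divergence f P1 Q + f_divergence f P2 Q
                      | Q in [set: probability T R]]]
    = (f (1 + V) + f (1 - V))%R%:E).
Proof.
have lower d (T : measurableType d) (P1 P2 : probability T R) (V : R) :
    tv_distance P1 P2 = V%:E ->
    (f (1 + V) + f (1 - V))%R%:E <=
    ereal_inf [set f_divergence f P1 Q + f_divergence f P2 Q
              | Q in [set: probability T R]].
  move=> tvV; apply: le_ereal_inf_tmp => _ [Q _ <-].
  exact: f_divergenceD_ge.
split=> // V V01; apply/eqP; rewrite eq_le; apply/andP; split.
(* The Bernoulli pair bounds the outer infimum from above, and the uniform law then bounds the inner
   one. *)
- have [tvV divV] := bernoulli_prob_extremal f V01.
  apply: (@le_trans _ _ (ereal_inf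
    [set f_divergence f (bernoulli_prob ((1 + V) / 2)%R) Q +
         f_divergence f (bernoulli_prob ((1 - V) / 2)%R) Q
    | Q in [set: probability bool R]])).
    apply: ereal_inf_lbound.
    by exists _, bool, (bernoulli_prob ((1 + V) / 2)%R), (bernoulli_prob ((1 - V) / 2)%R).
  rewrite -divV; apply: ereal_inf_lbound.
  by exists (bernoulli_prob (2^-1)%R).
- apply: le_ereal_inf_tmp => _ [d [T [P1 [P2 [tvV ->]]]]].
  exact: lower.
Qed.
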